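(* Let $R$ be a commutative ring with identity, let $1\le s\le l$ be integers, and let $A=(a_{i,j})\in M_{s\times l}(R)$ be such that $AA^t=\mathrm{diag}(\lambda_1,\dots,\lambda_s)$ for some $\lambda_1,\dots,\lambda_s\in R$. Suppose that $C_1,\dots,C_s$ are linear codes over $R$ of the same length such that, for each $i=1,\dots,s$, $C_i$ is self-orthogonal whenever $\lambda_i\neq 0$. Then the matrix-product code $[C_1\,\dots\,C_s]\,A$ is self-orthogonal.
   Context: $M_{s\times l}(R)$ is the set of $s\times l$ matrices over $R$; $A^t$ is the transpose of $A$; $\mathrm{diag}(\lambda_1,\dots,\lambda_s)$ is the $s\times s$ diagonal matrix with $(i,i)$ entry $\lambda_i$. A linear code of length $m$ over $R$ is an $R$-submodule of $R^m$. With $\langle x,y\rangle=\sum_{k} x_ky_k$, the dual of a linear code $C\subseteq R^m$ is $C^\perp=\{x\in R^m : \langle x,c\rangle=0 \text{ for all } c\in C\}$; $C$ is self-orthogonal if $C\subseteq C^\perp$. For linear codes $C_1,\dots,C_s$ of length $m$ and $A=(a_{i,j})\in M_{s\times l}(R)$, the matrix-product code is $[C_1\,\dots\,C_s]\,A=\{(c_1\,\dots\,c_s)A : c_i\in C_i\}$, where $(c_1\,\dots\,c_s)$ is the $m\times s$ matrix whose $i$th column is $c_i$. It is viewed as a linear code of length $ml$ by identifying an $m\times l$ matrix with the concatenation of its columns, so its codewords are $\left(\sum_{i=1}^s a_{i,1}c_i,\dots,\sum_{i=1}^s a_{i,l}c_i\right)$ with $c_i\in C_i$. *)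

(* Defs.v *)
From mathcomp Require Import all_boot all_order all_algebra.
From mathcomp Require Import classical_sets.

Set Implicit Arguments.
Unset Strict Implicit.
Unset Printing Implicit Defensive.

Import GRing.Theory.

Local Open Scope ring_scope.
Local Open Scope classical_set_scope.

(* Codes are sets of row vectors with classical (Prop-valued) membership, since
   a submodule over an arbitrary ring need not be decidable; [x \in C] is the
   classical membership of classical_sets.  The zero ring is allowed. *)
Section Codes.
Variables (R : comPzRingType) (m : nat).
Implicit Types (C : set 'rV[R]_m) (x y : 'rV[R]_m).

Definition linear_code C : Prop := GRing.submod_closed [in C].

Definition inner_product x y : R := \sum_(k < m) x 0 k * y 0 k.

Definition dual_code C : set 'rV[R]_m :=
  [set x | forall c, C c -> inner_product x c = 0].

Definition self_orthogonal C : Prop := C `<=` dual_code C.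

End Codes.

Section MatrixProductCode.
Variables (R : comPzRingType) (m s l : nat).

Definition columns_mx (c : 'I_s -> 'rV[R]_m) : 'M[R]_(m, s) :=
  \matrix_(k, i) c i 0 k.

(* [mxvec] concatenates rows, hence the transpose; the length is therefore
   written l * m. *)
Definition concat_columns (M : 'M[R]_(m, l)) : 'rV[R]_(l * m) := mxvec M^T.

Definition matrix_product_code (C : 'I_s -> set 'rV[R]_m) (A : 'M[R]_(s, l)) :
    set 'rV[R]_(l * m) :=
  [set concat_columns (columns_mx c *m A) | c in [set c | forall i, C i (c i)]].

Lemma matrix_product_codewordE (c : 'I_s -> 'rV[R]_m) (A : 'M[R]_(s, l))
    (j : 'I_l) (k : 'I_m) :
  concat_columns (columns_mx c *m A) 0 (mxvec_index j k) =
  (\sum_(i < s) A i j *: c i) 0 k.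
Proof.
rewrite /concat_columns mxvecE !mxE summxE.
by apply: eq_bigr => i _; rewrite !mxE mulrC.
Qed.

Lemma matrix_product_code_linear (C : 'I_s -> set 'rV[R]_m)
    (A : 'M[R]_(s, l)) :
  (forall i, linear_code (C i)) -> linear_code (matrix_product_code C A).
Proof.
move=> linC; split.
  apply/mem_set; exists (fun=> 0); first by move=> i; apply/set_mem/(linC i).1.
  suff -> : columns_mx (fun=> 0) = 0.
    by rewrite mul0mx /concat_columns trmx0 linear0.
  by apply/matrixP => k i; rewrite !mxE.
move=> a _ _ /set_mem[c Cc <-] /set_mem[d Cd <-].
apply/mem_set; exists (fun i => a *: c i + d i).
  by move=> i; apply/set_mem/(linC i).2; apply/mem_set; [apply: Cc|apply: Cd].
suff -> : columns_mx (fun i => a *: c i + d i) =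
          a *: columns_mx c + columns_mx d.
  by rewrite /concat_columns mulmxDl -scalemxAl !linearP.
by apply/matrixP => k i; rewrite !mxE.
Qed.

End MatrixProductCode.

(* Main.v *)
(* Identifying codewords with matrices, the inner product of [cA] and [dA] is
   tr (c A A^t d^t) = tr (c diag(lambda) d^t) = sum_i lambda_i <c_i, d_i>, and
   each term vanishes because either lambda_i = 0 or C_i is self-orthogonal. *)
Require Import Defs.
From mathcomp Require Import all_boot all_order all_algebra.
From mathcomp Require Import classical_sets.

Import GRing.Theory.

Local Open Scope ring_scope.
Local Open Scope classical_set_scope.

(** Both sides sum [M k j * N k j] over all positions; [mxvec_index] turns an index of the
    concatenation into a pair. *)
Lemma inner_product_concat_columns (R : comPzRingType) (m l : nat)
    (M N : 'M[R]_(m, l)) :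
  inner_product (concat_columns M) (concat_columns N) = \tr (M *m N^T).
Proof.
rewrite /inner_product (reindex _ (curry_mxvec_bij l m)) /=.
rewrite /mxtrace; under [RHS]eq_bigr => k _ do rewrite mxE.
(* [concat_columns] transposes, so the pairs on the left are (column, row). *)
rewrite exchange_big pair_bigA; apply: eq_bigr => -[j k] _ /=.
by rewrite !mxvecE !mxE.
Qed.

(** The [k]-th diagonal entry collects the [k]-th terms of all the inner products; exchanging sums
    regroups them by [i]. *)
Lemma mxtrace_columns_mx_diag (R : comPzRingType) (m s : nat)
    (lambda : 'rV[R]_s) (c d : 'I_s -> 'rV[R]_m) :
  \tr (columns_mx c *m diag_mx lambda *m (columns_mx d)^T) =
  \sum_(i < s) lambda 0 i * inner_product (c i) (d i).
Proof.
under [RHS]eq_bigr => i _ do rewrite mulr_sumr.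
rewrite exchange_big; apply: eq_bigr => k _; rewrite mul_mx_diag mxE.
by apply: eq_bigr => i _; rewrite !mxE mulrA [lambda _ _ * _]mulrC.
Qed.

Theorem theorem3p1 (R : comPzRingType) (m s l : nat)
    (A : 'M[R]_(s, l)) (lambda : 'rV[R]_s) (C : 'I_s -> set 'rV[R]_m) :
  (1 <= s)%N -> (s <= l)%N ->
  A *m A^T = diag_mx lambda ->
  (forall i, linear_code (C i)) ->
  (forall i, lambda 0 i <> 0 -> self_orthogonal (C i)) ->
  self_orthogonal (matrix_product_code C A).
Proof.
move=> _ _ AAt _ orthC _ [c Cc <-] _ [d Cd <-].
(* Reassociating isolates [A *m A^T] in the middle of the product. *)
rewrite inner_product_concat_columns trmx_mul mulmxA -(mulmxA _ A) AAt.
rewrite mxtrace_columns_mx_diag big1 // => i _.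
have [->|/eqP lambda_neq0] := eqVneq (lambda 0 i) 0; first by rewrite mul0r.
by rewrite (orthC i lambda_neq0 _ (Cc i) _ (Cd i)) mulr0.
Qed.
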